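(* Let $(\mathcal{R}, \leq, r)$ be a triple satisfying axioms A.1–A.4 below, such that $\mathcal{AR}$ is countable, $\mathcal{R}$ is closed as a subspace of $\mathcal{AR}^\omega$ (with $\mathcal{AR}$ discrete, identifying $A\in\mathcal{R}$ with $(r_n(A))_{n<\omega}$), and $(\mathcal{R}, \leq, r)$ is well-indexed. Then the set $C=\{x \in 2^\omega \mid G_x \text{ is Ramsey positive}\}$ of codes for $G_\delta$ Ramsey positive subsets of $\mathcal{R}$ is $\mathbf{\Sigma}^1_2$-complete.
   Context: Setting: $\mathcal{R}$ is a non-empty set, $\leq$ is a reflexive transitive relation on $\mathcal{R}$, and $r:\mathcal{R}\times\omega\to\mathcal{AR}$ where $\mathcal{AR}$ is a set (''finite approximations''); write $r_n(A)=r(A,n)$, $\mathcal{AR}_n=\{r_n(A)\mid A\in\mathcal{R}\}$, and for $a\in\mathcal{AR}_n$ write $|a|=n$. For $s\in\mathcal{AR}$, $A\in\mathcal{R}$: $s\sqsubseteq A$ iff $s=r_n(A)$ for some $n$; for $s,t\in\mathcal{AR}$: $s\sqsubseteq t$ iff there are $A$ and $m\le n$ with $s=r_m(A)$, $t=r_n(A)$. Let $[s,A]=\{B\in\mathcal{R}\mid s\sqsubseteq B,\ B\le A\}$ and $[n,A]=[r_n(A),A]$. Axioms (Todorčević): A.1 (Metrization) $r_0(A)=\emptyset$ for all $A$; $A\neq B$ implies $r_n(A)\ne r_n(B)$ for some $n$; $r_n(A)=r_m(B)$ implies $n=m$ and $r_k(A)=r_k(B)$ for all $k<n$. A.2 (Finitization)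 there is a quasi-order $\le_{\mathrm{fin}}$ on $\mathcal{AR}$ such that $\{a\mid a\le_{\mathrm{fin}} b\}$ is finite for every $b$; $A\le B$ iff for every $n$ there is $m$ with $r_n(A)\le_{\mathrm{fin}} r_m(B)$; and for all $a,b,c\in\mathcal{AR}$, if $a\sqsubseteq b$ and $b\le_{\mathrm{fin}} c$ then there is $d\sqsubseteq c$ with $a\le_{\mathrm{fin}} d$. Let $\mathrm{depth}_B(a)=\min\{n\mid a\le_{\mathrm{fin}} r_n(B)\}$ if this exists, else $\infty$. A.3 (Amalgamation) if $\mathrm{depth}_B(a)=n<\infty$ then $[a,A]\neq\emptyset$ for all $A\in[n,B]$; and if $A\le B$ and $[a,A]\ne\emptyset$ then there is $A'\in[n,B]$ with $\emptyset\ne[a,A']\subseteq[a,A]$. A.4 (Pigeonhole) if $\mathrm{depth}_B(a)=n<\infty$ and $\mathcal{O}\subseteq\mathcal{AR}_{|a|+1}$, then there is $A\in[n,B]$ such that $\{r_{|a|+1}(C)\mid C\in[a,A]\}\subseteq\mathcal{O}$ or is disjoint from $\mathcal{O}$. Ramsey notions: $\mathcal{X}\subseteq\mathcal{R}$ is Ramsey null if for every non-empty $[s,A]$ there is $B\in[s,A]$ with $[s,B]\cap\mathcal{X}=\emptyset$; otherwise $\mathcal{X}$ is Ramsey positive. Codes: fix a bijection $e:\omega\times\mathcal{AR}\to\omega$; $x\in2^\omega$ codes the sequence $\langle X_n\mid n<\omega\rangle$ with $X_n=\{s\in\mathcal{AR}\mid x(e(n,s))=1\}$. A set $X\subseteq\mathcal{AR}$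 is a tree if it is closed under $\sqsubseteq$-initial segments; $[X]=\{A\in\mathcal{R}\mid\forall k\ r_k(A)\in X\}$. Set $G_x=\mathcal{R}\setminus\bigcup_n[X_n]$ if every $X_n$ is a tree, and $G_x=\emptyset$ otherwise. Well-indexed: for $m:\mathcal{AR}\to\omega$ put $\ell(s)=\{m(t)\mid \emptyset\ne t\sqsubseteq s\}$ and $\overline{\ell}(A)=\{m(t)\mid\emptyset\ne t\sqsubseteq A\}$. For $s'\in[\omega]^{<\omega}$, $A'\in[\omega]^\omega$, let $[s',A']=\{B'\in[\omega]^\omega\mid s'\text{ is an initial segment of }B',\ B'\subseteq A'\}$. $(\mathcal{R},\le,r)$ is well-indexed if there is $m:\mathcal{AR}\to\omega$ with: (1) $s\sqsubseteq t$ implies $m(s)\le m(t)$; (2) $\overline{\ell}(A)\in[\omega]^\omega$ for all $A$; (3) there is $A^*$ with $\overline{\ell}(A)\subseteq\overline{\ell}(A^* )$ for all $A$, and $\overline{\ell}(B)\subseteq\overline{\ell}(A)$ whenever $B\le A\le A^*$; (4) for any $s\sqsubseteq A$ and $B'\in[\ell(s),\overline{\ell}(A)]$ with $|\overline{\ell}(A)\setminus B'|=1$, there is $B\in[s,A]$ with $\overline{\ell}(B)=B'$. *)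

(* Defs.v *)
From mathcomp Require Import all_boot.
From mathcomp Require Import all_classical all_reals topology cantor.

Set Implicit Arguments.
Unset Strict Implicit.
Unset Printing Implicit Defensive.

Local Open Scope classical_set_scope.

Definition baire_space : topologicalType := prod_topology (fun _ : nat => nat).

(* The boldface projective classes, by projections along Baire space. They
   are the usual classes when X is Polish. *)
Definition sigma11 (X : topologicalType) (A : set X) : Prop :=
  exists2 F : set (X * baire_space), closed F & A = fst @` F.

Definition pi11 (X : topologicalType) (A : set X) : Prop := sigma11 (~` A).

Definition sigma12 (X : topologicalType) (A : set X) : Prop :=
  exists2 F : set (X * baire_space), pi11 F & A = fst @` F.

Definition polish (R : realType) (X : metricType R) : Prop :=
  (exists2 D : set X, countable D & dense D) /\
  (forall u : nat -> X, cauchy (u @ \oo) -> exists x : X, u @ \oo --> x).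

(* The library's [zero_dimensional] only asks that distinct points be
   separated by a clopen set, which is weaker than having a clopen basis. *)
Definition clopen_based (X : topologicalType) : Prop := basis (@clopen X).

(* Hardness is with respect to continuous (Wadge) reductions from subsets of
   arbitrary zero-dimensional Polish spaces. *)
Definition sigma12_complete (R : realType) (Y : topologicalType) (A : set Y)
    : Prop :=
  sigma12 A /\
  forall X : metricType R, polish X -> clopen_based X ->
    forall B : set X, sigma12 B ->
      exists2 f : X -> Y, continuous f & B = f @^-1` A.

(* [emp] is the element of AR written as the empty set. AR is not required to
   be the union of the AR_n, and |a| = n is rendered as [AR_n n a]. *)
Record approx_triple := ApproxTriple {
  pt : Type;
  AR : Type;
  ple : pt -> pt -> Prop;
  approx : pt -> nat -> AR;
  emp : AR;
  pt_inhabited : inhabited pt;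
  ple_refl : forall A, ple A A;
  ple_trans : forall A B C, ple A B -> ple B C -> ple A C
}.

Arguments ple {a}.
Arguments approx {a}.
Arguments emp {a}.

Section Triple.
Variable T : approx_triple.
Implicit Types (A B C : pt T) (s t a b c : AR T).

Definition AR_n (n : nat) : set (AR T) := range (fun A => approx A n).

Definition init_pt s A : Prop := exists n, s = approx A n.

Definition init_ar s t : Prop :=
  exists A m n, [/\ (m <= n)%N, s = approx A m & t = approx A n].

Definition nbase s A : set (pt T) := [set B | init_pt s B /\ ple B A].

Definition nbase_n (n : nat) A : set (pt T) := nbase (approx A n) A.

Definition axiom_A1 : Prop :=
  [/\ forall A, approx A 0%N = emp,
      forall A B, A <> B -> exists n, approx A n <> approx B n &
      forall A B n m, approx A n = approx B m ->
        n = m /\ forall k, (k < n)%N -> approx A k = approx B k].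

Section Fin.
Variable lefin : AR T -> AR T -> Prop.

Definition axiom_A2 : Prop :=
  [/\ (forall a, lefin a a) /\
        (forall a b c, lefin a b -> lefin b c -> lefin a c),
      forall b, finite_set [set a | lefin a b],
      forall A B, ple A B <-> forall n, exists m, lefin (approx A n) (approx B m) &
      forall a b c, init_ar a b -> lefin b c ->
        exists2 d, init_ar d c & lefin a d].

(* depth_B(a) = n < oo *)
Definition depth_eq B a (n : nat) : Prop :=
  lefin a (approx B n) /\ forall k, lefin a (approx B k) -> (n <= k)%N.

Definition axiom_A3 : Prop :=
  forall B a n, depth_eq B a n ->
    (forall A, nbase_n n B A -> nbase a A !=set0) /\
    (forall A, ple A B -> nbase a A !=set0 ->
      exists2 A', nbase_n n B A' &
        nbase a A' !=set0 /\ nbase a A' `<=` nbase a A).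

Definition axiom_A4 : Prop :=
  forall B a n k (O : set (AR T)),
    depth_eq B a n -> AR_n k a -> O `<=` AR_n k.+1 ->
    exists2 A, nbase_n n B A &
      [set approx C k.+1 | C in nbase a A] `<=` O \/
      [set approx C k.+1 | C in nbase a A] `&` O = set0.

End Fin.

Definition axioms_A1_A4 : Prop :=
  axiom_A1 /\
  exists lefin, [/\ axiom_A2 lefin, axiom_A3 lefin & axiom_A4 lefin].

Definition closed_in_AR_omega : Prop :=
  closed (range approx :
    set (prod_topology (fun _ : nat => discrete_topology {classic AR T}))).

Definition ramsey_null (X : set (pt T)) : Prop :=
  forall s A, nbase s A !=set0 ->
    exists2 B, nbase s A B & nbase s B `&` X = set0.

Definition ramsey_positive (X : set (pt T)) : Prop := ~ ramsey_null X.

Definition is_tree (X : set (AR T)) : Prop :=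
  forall s t, init_ar s t -> X t -> X s.

Definition branches (X : set (AR T)) : set (pt T) :=
  [set A | forall k, X (approx A k)].

Definition coded_seq (e : nat * AR T -> nat) (x : cantor_space) (n : nat)
    : set (AR T) :=
  [set s | x (e (n, s)) = true].

Definition coded_Gdelta (e : nat * AR T -> nat) (x : cantor_space)
    : set (pt T) :=
  if `[< forall n, is_tree (coded_seq e x n) >]
  then ~` \bigcup_n branches (coded_seq e x n)
  else set0.

Definition positive_codes (e : nat * AR T -> nat) : set cantor_space :=
  [set x | ramsey_positive (coded_Gdelta e x)].

Definition ell (m : AR T -> nat) s : set nat :=
  [set m t | t in [set t | emp <> t /\ init_ar t s]].

Definition ellbar (m : AR T -> nat) A : set nat :=
  [set m t | t in [set t | emp <> t /\ init_pt t A]].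

(* The Ellentuck neighbourhood [s', A'] in [omega]^omega. *)
Definition ellentuck (s' A' : set nat) : set (set nat) :=
  [set B' | [/\ infinite_set B',
                s' `<=` B' /\
                  (forall i j, s' i -> B' j -> (j <= i)%N -> s' j) &
                B' `<=` A']].

Definition well_indexed : Prop :=
  exists m : AR T -> nat,
  [/\ forall s t, init_ar s t -> (m s <= m t)%N,
      forall A, infinite_set (ellbar m A),
      exists Astar, (forall A, ellbar m A `<=` ellbar m Astar) /\
        (forall A B, ple B A -> ple A Astar -> ellbar m B `<=` ellbar m A) &
      forall s A (B' : set nat), init_pt s A ->
        ellentuck (ell m s) (ellbar m A) B' ->
        (exists k, ellbar m A `\` B' = [set k]) ->
        exists2 B, nbase s A B & ellbar m B = B'].

End Triple.

(* Main.v *)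
(* Upper bound. Combinatorial forcing and fusion (A.3, A.4) show that every
   F_sigma set is Ramsey, so G_x is Ramsey positive exactly when it contains a
   non-empty basic set [s,A]; containment is a Pi^1_1 condition on (x, A).

   Hardness. Enumerate l(A^* ) by the finite sequences sigma_k of naturals.
   Let B be the projection of P, and the complement of P the projection of a
   closed set F. To x we attach the set of those A for which the sequences
   sigma_k, k in l(A), are the initial segments of some y, and the section
   F_(x,y) has no branch z which is eventually dominated by l(A), meaning
   z(i) <= b' whenever i <= b < b' in l(A). By compactness of the dominated
   branches this set is G_delta, uniformly in x. If (x,y) is in P, it contains
   every A with l(A) inside {k | sigma_k is an initial segment of y}; if x is
   not in B, then by thinning out l(A) every [s,A] has an element outside it. *)

Require Import Defs.
From mathcomp Require Import all_boot all_order all_algebra.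
From mathcomp Require Import all_classical all_reals topology cantor.
Import Order.TTheory GRing.Theory Num.Theory.
Local Open Scope classical_set_scope.

Set Implicit Arguments.
Unset Strict Implicit.
Unset Printing Implicit Defensive.

(** * Sequence spaces and sets of naturals *)

(** The target carries no topology, so that maps into [nat], [AR T] and [Prop] are treated alike.
    For [U := Prop] the notion says that the set [f] is clopen. *)
Definition locally_constant (X : topologicalType) (U : Type) (f : X -> U) : Prop :=
  forall x, \forall y \near x, f y = f x.

Section LocallyConstant.
Context {X Y : topologicalType}.

Lemma locally_constant_cst (U : Type) (u : U) :
  locally_constant (fun _ : X => u).
Proof. by move=> x; apply: nearW. Qed.

Lemma locally_constant_comp (U V : Type) (g : U -> V) (f : X -> U) :
  locally_constant f -> locally_constant (fun x => g (f x)).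
Proof. by move=> cf x; apply: filterS (cf x) => y ->. Qed.

Lemma locally_constant_comp2 (U V W : Type) (h : U -> V -> W) (f : X -> U)
    (g : X -> V) :
  locally_constant f -> locally_constant g ->
  locally_constant (fun x => h (f x) (g x)).
Proof. by move=> cf cg x; apply: filterS2 (cf x) (cg x) => y -> ->. Qed.

(** Covers reading a sequence at an index that itself depends on the point. *)
Lemma locally_constant_dep (U V : Type) (g : U -> X -> V) (f : X -> U) :
  (forall u, locally_constant (g u)) -> locally_constant f ->
  locally_constant (fun x => g (f x) x).
Proof. by move=> cg cf x; apply: filterS2 (cf x) (cg (f x) x) => y -> ->. Qed.

Lemma locally_constant_continuous_comp (U : Type) (f : Y -> U) (h : X -> Y) :
  continuous h -> locally_constant f -> locally_constant (fun x => f (h x)).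
Proof. by move=> ch cf x; exact: (ch x _ (cf (h x))). Qed.

Lemma closed_forall_locally_constant (I : Type) (P : I -> X -> Prop) :
  (forall i, locally_constant (P i)) -> closed [set x | forall i, P i x].
Proof.
move=> cP x clx i.
by have [y [Py <-]] := clx _ (cP i x); exact: Py.
Qed.

End LocallyConstant.

Lemma near_prefix (X : topologicalType) (U : Type) (g : X -> nat -> U) n :
  (forall i, locally_constant (fun x => g x i)) ->
  forall x, \forall y \near x, forall i, (i < n)%N -> g y i = g x i.
Proof.
move=> cg x; elim: n => [|n ih]; first exact: nearW.
apply: filterS2 ih (cg n x) => y yn gyn i.
by rewrite ltnS leq_eqVlt => /orP[/eqP->//|]; exact: yn.
Qed.

Lemma locally_constant_prefix (X : topologicalType) (U V : Type)
    (g : X -> nat -> U) (Q : (nat -> U) -> V) n :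
  (forall a b, (forall i, (i < n)%N -> a i = b i) -> Q a = Q b) ->
  (forall i, locally_constant (fun x => g x i)) ->
  locally_constant (fun x => Q (g x)).
Proof. by move=> Qn cg x; apply: filterS (near_prefix n cg x) => y /Qn. Qed.

(** If every [n] failed, the counterexamples [b n] would converge to [a] coordinatewise, hence in
    the product, without ever entering [V]. *)
Lemma nbhs_cylinder (U : topologicalType) (a : prod_topology (fun _ : nat => U))
    (V : set (prod_topology (fun _ : nat => U))) :
  nbhs a V ->
  exists n, forall b : nat -> U, (forall i, (i < n)%N -> b i = a i) -> V b.
Proof.
move=> nV; apply: contrapT => noV.
have /choice[b bP] (n : nat) : exists b : prod_topology (fun _ : nat => U),
    (forall i, (i < n)%N -> b i = a i) /\ ~ V b.
  apply: contrapT => nob; apply: noV; exists n => b ba.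
  by apply: contrapT => nVb; apply: nob; exists b.
have ba : b @ \oo --> a.
  apply/cvg_sup => i W [W' [[O oO <-] Oai]] W'W.
  apply: filterS W'W _; rewrite nbhs_simpl; exists i.+1 => // n /= lin.
  by rewrite (bP n).1.
have [N _ VN] := ba _ nV.
by apply: (bP N).2; apply: VN => /=.
Qed.

Lemma locally_constant_coord (U : discreteTopologicalType) (i : nat) :
  locally_constant (fun a : prod_topology (fun _ : nat => U) => a i).
Proof.
move=> a; have := @proj_continuous nat (fun _ => U) i a.
by move=> /(_ _ (discrete_set1 _)).
Qed.

Lemma locally_constant_continuous (X : topologicalType)
    (U : discreteTopologicalType) (f : X -> prod_topology (fun _ : nat => U)) :
  (forall i, locally_constant (fun x => f x i)) -> continuous f.
Proof.
move=> cf x V /nbhs_cylinder[n Vn].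
by apply: filterS (near_prefix n cf x) => y; exact: Vn.
Qed.

(** * Countable bases of separable metric spaces *)

Lemma separable_countable_base (R : realType) (X : metricType R) :
  (exists2 D : set X, countable D & dense D) ->
  exists V : nat -> set X, (forall i, open (V i)) /\
    forall x W, nbhs x W -> exists i, V i x /\ V i `<=` W.
Proof.
move=> [D /countable_injP[g gD] dD].
pose rad n : R := (n.+1%:R^-1)%R.
(* As [g] is injective on [D], the union has at most one member; it is empty if [p.1] indexes no
   point of [D]. *)
pose V' (p : nat * nat) : set X :=
  \bigcup_(d in [set d | D d /\ g d = p.1]) (ball d (rad p.2))^°.
exists (fun i => if unpickle i is Some p then V' p else set0).
split=> [i|x W /nbhs_ballP[r /= r0 xrW]].
  case: unpickle => [p|]; last exact: open0.
  by apply: bigcup_open => d _; exact: open_interior.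
have [n nr] : exists n, (rad n < r / 2)%R.
  have /ltr_add_invr[n] : (0 < r / 2)%R by rewrite divr_gt0.
  by rewrite add0r; exists n.
have e0 : (0 < rad n)%R by rewrite invr_gt0 ltr0n.
have [d [xd Dd]] : (ball x (rad n / 2)%R)^° `&` D !=set0.
  apply: dD; last exact: open_interior.
  by exists x; apply: nbhsx_ballx; rewrite divr_gt0.
move/interior_subset : xd => xd.
have Vxd : V' (g d, n) `<=` ball d (rad n).
  move=> z [d' [Dd' gd']] /interior_subset.
  by rewrite (gD d' d) ?inE.
exists (pickle (g d, n)); rewrite pickleK; split.
  exists d => //; apply/nbhs_ballP; exists (rad n / 2)%R => /=.
    by rewrite divr_gt0.
  by move=> z xz; apply: ball_splitr xz; exact: xd.
move=> z /Vxd dz; apply: xrW.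
apply: (@ball_split _ _ d).
  apply: le_ball xd; apply: le_trans (ltW nr).
  by rewrite ler_pdivrMr // ler_peMr ?(ltW e0)// ler1n.
exact: le_ball (ltW nr) _ dz.
Qed.

(** For each pair of basic open sets [V i], [V j] that have a clopen set between them, one such set
    is kept; these countably many sets still form a basis. *)
Lemma separable_countable_clopen_base (R : realType) (X : metricType R) :
  (exists2 D : set X, countable D & dense D) -> clopen_based X ->
  exists U : nat -> set X, (forall i, clopen (U i)) /\
    forall x W, nbhs x W -> exists i, U i x /\ U i `<=` W.
Proof.
move=> /separable_countable_base[V [oV Vbase]] [_ clb].
pose Q (p : nat * nat) : set (set X) :=
  [set C | clopen C /\ V p.1 `<=` C /\ C `<=` V p.2].
have c0 : clopen (set0 : set X) by split; [exact: open0|exact: closed0].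
exists (fun i => if unpickle i is Some p then xget set0 (Q p) else set0).
split=> [i|x W].
  case: unpickle => [p|] //.
  by case: xgetP => // C _ [].
move=> /Vbase[j [Vjx VjW]].
have [C [clC Cx] CV] := clb x (V j) (open_nbhs_nbhs (conj (oV j) Vjx)).
have [i [Vix ViC]] := Vbase x C (open_nbhs_nbhs (conj clC.1 Cx)).
have [Ex [ViE EVj]] : Q (i, j) (xget set0 (Q (i, j))).
  by apply: (@xgetPex _ set0); exists C.
exists (pickle (i, j)); rewrite pickleK; split; first exact: ViE.
exact: subset_trans EVj VjW.
Qed.

(** * Infinite sets of naturals and bounded families of sequences *)

Lemma infinite_natP (E : set nat) :
  infinite_set E <-> forall n, exists2 k, E k & (n <= k)%N.
Proof.
split=> [infE n|unb finE].
  apply: contrapT => nok; apply: infE; apply: sub_finite_set (finite_II n) => k Ek.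
  by rewrite /= ltnNge; apply/negP => nk; apply: nok; exists k.
have /finite_seqP[s Es] := finE.
have [k] := unb (\max_(i <- s) i).+1.
by rewrite Es /= => ks; rewrite ltnNge leq_bigmax_seq.
Qed.

(** Greedy choice: [f n.+1] is an element of [E] beyond [f n] and beyond all values of [h] on
    [0, f n]. *)
Lemma sparse_subset (E : set nat) (h : nat -> nat) :
  infinite_set E ->
  exists S : set nat, [/\ S `<=` E, infinite_set S &
    forall b b', S b -> S b' -> (b < b')%N -> forall i, (i <= b)%N -> (h i <= b')%N].
Proof.
move=> /infinite_natP Einf.
have /choice[g gP] (n : nat) : exists k, E k /\ (n <= k)%N.
  by have [k] := Einf n; exists k.
pose H k := \max_(i < k.+1) h i.
pose f := fix f n := if n is n'.+1 then g (maxn (f n').+1 (H (f n'))) else g 0.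
have fS n : (f n < f n.+1)%N /\ (H (f n) <= f n.+1)%N.
  by apply/andP; rewrite -geq_max; apply: (gP _).2.
have f_lt : {mono f : m n / (m < n)%N}.
  exact: leqW_mono (leq_mono (homo_ltn ltn_trans (fun n => (fS n).1))).
have f_ge n : (n <= f n)%N.
  by elim: n => // n ih; apply: leq_ltn_trans ih (fS n).1.
exists (range f); split.
- by move=> _ [[|n] _ <-]; exact: (gP _).1.
- by apply/infinite_natP => n; exists (f n).
move=> _ _ [m _ <-] [n _ <-]; rewrite f_lt => mn i im.
case: n mn => // n; rewrite ltnS => mn; apply: leq_trans (fS n).2.
have ifn : (i < (f n).+1)%N.
  by rewrite ltnS (leq_trans im) // leqNgt f_lt -leqNgt.
exact: (leq_bigmax (Ordinal ifn)).
Qed.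

Lemma bounded_cluster (z : nat -> nat -> nat) (h : nat -> nat) :
  (forall i, exists n0, forall n, (n0 <= n)%N -> (z n i <= h i)%N) ->
  exists w : nat -> nat, forall M n0,
    exists2 n, (n0 <= n)%N & forall i, (i < M)%N -> z n i = w i.
Proof.
move=> zh.
have Kc : compact [set f : baire_space | forall i, (f i <= h i)%N].
  apply: (@tychonoff nat (fun _ => nat) (fun i => [set k | (k <= h i)%N])) => i.
  apply: finite_compact; apply: sub_finite_set (finite_II (h i).+1) => k.
  by rewrite /= ltnS.
(* Coordinate [i] obeys its bound only from some term on. Truncation puts every term into the
   compact box and leaves the first [M] coordinates of late terms unchanged. *)
pose z' : nat -> baire_space := fun n i => minn (z n i) (h i).
have [w [_ wcl]] : [set f : baire_space | forall i, (f i <= h i)%N] `&`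
    cluster (z' @ \oo) !=set0.
  by apply: Kc; exists 0%N => // n _ i /=; exact: geq_minr.
exists w => M n0.
have [n1 n1P] : exists n1, forall i, (i < M)%N -> forall n, (n1 <= n)%N -> (z n i <= h i)%N.
  elim: M => [|M [n1 ih]]; first by exists 0%N.
  have [n2 n2P] := zh M; exists (maxn n1 n2) => i.
  rewrite ltnS leq_eqVlt => /orP[/eqP-> n|iM n]; rewrite geq_max => /andP[h1 h2].
    exact: n2P.
  exact: ih.
have wM : \forall f \near w, forall i, (i < M)%N -> f i = w i.
  exact: (@near_prefix baire_space nat id M (@locally_constant_coord nat)) w.
have [_ [[n /= nn1 <-] nw]] : z' @` [set n | (maxn n0 n1 <= n)%N] `&`
    [set f | forall i, (i < M)%N -> f i = w i] !=set0.
  apply: wcl wM; exists (maxn n0 n1) => // n nn /=.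
  by exists n.
move: nn1; rewrite geq_max => /andP[nn0 nn1]; exists n => // i iM.
by rewrite -(nw i iM) /z'; apply/esym/minn_idPl; exact: n1P.
Qed.

(** * The Ramsey property of F_sigma sets *)

Section Approximations.
Variable T : approx_triple.
Hypothesis A1 : axiom_A1 T.
Implicit Types (A B C D E : pt T) (s t : AR T).

Lemma approx_inj A B n m : approx A n = approx B m ->
  n = m /\ forall k, (k <= n)%N -> approx A k = approx B k.
Proof.
case: A1 => _ _ A13 e; have [nm h] := A13 _ _ _ _ e; split=> // k.
by rewrite leq_eqVlt => /orP[/eqP->|/h//]; rewrite {2}nm.
Qed.

Lemma approx_le A B n k :
  approx A n = approx B n -> (k <= n)%N -> approx A k = approx B k.
Proof. by move=> /approx_inj[_]; exact. Qed.

Lemma init_ptE A B n : init_pt (approx A n) B -> approx B n = approx A n.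
Proof. by case=> m e; have [nm _] := approx_inj e; rewrite e -nm. Qed.

Lemma init_arE s A n :
  init_ar s (approx A n) -> exists2 i, (i <= n)%N & s = approx A i.
Proof.
move=> [B [i [j [ij -> e]]]]; have [nj h] := approx_inj e.
by exists i; rewrite ?h // nj.
Qed.

Lemma init_ar_approx A i j : (i <= j)%N -> init_ar (approx A i) (approx A j).
Proof. by move=> ij; exists A, i, j. Qed.

Lemma init_ar_pt s t A : init_ar s t -> init_pt t A -> init_pt s A.
Proof. by move=> st [n tA]; move: st; rewrite tA => /init_arE[i _ ->]; exists i. Qed.

Lemma init_ar_trans s t u : init_ar s t -> init_ar t u -> init_ar s u.
Proof.
move=> st [A [i [j [ij tA ->]]]]; move: st; rewrite tA => /init_arE[k ki ->].
exact/init_ar_approx/(leq_trans ki).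
Qed.

Lemma init_ar_refl t A : init_pt t A -> init_ar t t.
Proof. by case=> n ->; exact: init_ar_approx. Qed.

Lemma nbase_refl t A : init_pt t A -> nbase t A A.
Proof. by split=> //; exact: ple_refl. Qed.

Lemma nbase_sub t A B : ple A B -> nbase t A `<=` nbase t B.
Proof. by move=> AB C [tC CA]; split=> //; exact: ple_trans AB. Qed.

Lemma approx_limit (a : nat -> AR T) : closed_in_AR_omega T ->
  (forall n, exists A, forall i, (i < n)%N -> approx A i = a i) ->
  exists A, forall i, approx A i = a i.
Proof.
move=> clT lim.
have [A _ Aa] : range approx a.
  apply: (clT a) => V /nbhs_cylinder[n Vn]; have [A Aa] := lim n.
  by exists (approx A); split; [exists A|exact: Vn].
by exists A => i; rewrite Aa.
Qed.

Lemma approx_fusion (u : nat -> pt T) (p : nat -> nat) : closed_in_AR_omega T ->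
  {homo p : m n / (m <= n)%N} -> (forall k, exists n, (k <= p n)%N) ->
  (forall n, approx (u n.+1) (p n) = approx (u n) (p n)) ->
  exists A, forall n, approx A (p n) = approx (u n) (p n).
Proof.
move=> clT p_homo /choice[q qP] up.
have st n m i : (n <= m)%N -> (i <= p n)%N -> approx (u m) i = approx (u n) i.
  move=> /subnK <-; elim: (m - n)%N => // k ih ipn; rewrite addSn -ih //.
  apply: approx_le (up _) _.
  by apply: leq_trans ipn _; apply: p_homo; rewrite leq_addl.
have agree n m i : (i <= p n)%N -> (i <= p m)%N -> approx (u m) i = approx (u n) i.
  move=> ipn ipm; rewrite -(st n (maxn n m)) ?leq_maxl //.
  by rewrite -(st m (maxn n m)) ?leq_maxr.
have [|A AP] := @approx_limit (fun i => approx (u (q i)) i) clT.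
  move=> n; exists (u (q n)) => i lin; apply: agree => //.
  exact: leq_trans (ltnW lin) _.
by exists A => n; rewrite AP; apply: agree.
Qed.

End Approximations.

(** * Fusion and combinatorial forcing *)

Section Ramsey.
Variable T : approx_triple.
Variable lefin : AR T -> AR T -> Prop.
Hypothesis A1 : axiom_A1 T.
Hypothesis clT : closed_in_AR_omega T.
Hypothesis A2 : axiom_A2 lefin.
Hypothesis A3 : axiom_A3 lefin.
Hypothesis A4 : axiom_A4 lefin.
Implicit Types (A B C D E : pt T) (s t : AR T).

Lemma depth_eq_ex B t m :
  lefin t (approx B m) -> exists n, depth_eq lefin B t n.
Proof.
move=> tm; have [|n /asboolP tn nmin] := @ex_minnP (fun n => `[< lefin t (approx B n) >]).
  by exists m; apply/asboolP.
by exists n; split=> // k tk; apply: nmin; apply/asboolP.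
Qed.

Lemma nbase_depth t B : nbase t B !=set0 -> exists n, depth_eq lefin B t n.
Proof.
case: A2 => _ _ /(_ _ B) pleE _ [C [[k ->]]] /pleE/(_ k)[m].
exact: depth_eq_ex.
Qed.

Lemma depth_eq_agree B C t n :
  approx C n = approx B n -> depth_eq lefin B t n -> depth_eq lefin C t n.
Proof.
move=> e [tn nmin]; split; first by rewrite e.
move=> k tk; rewrite leqNgt; apply/negP => kn.
by move: (kn); rewrite ltnNge nmin // -(approx_le A1 e) // ltnW.
Qed.

Lemma depth_nbase B C t n :
  depth_eq lefin B t n -> nbase_n n B C -> nbase t C !=set0.
Proof. by move=> /A3[+ _]; apply. Qed.

(** By A.2, [ple B (u n)] is a condition on each approximation of [B] separately, and each of these
    is also an approximation of some later [u M], which lies below [u n]. *)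
Lemma ple_fusion (u : nat -> pt T) (p : nat -> nat) B :
  {homo p : m n / (m <= n)%N} -> (forall k, exists n, (k <= p n)%N) ->
  (forall n, ple (u n.+1) (u n)) ->
  (forall n, approx B (p n) = approx (u n) (p n)) ->
  forall n, ple B (u n).
Proof.
move=> p_homo p_unb uS uB n; case: (A2) => _ _ pleE _; apply/pleE => k.
have [N kN] := p_unb k.
have un m : (n <= m)%N -> ple (u m) (u n).
  move=> /subnK <-; elim: (m - n)%N => [|j ih]; first exact: ple_refl.
  exact: ple_trans (uS _) ih.
have kM : (k <= p (maxn n N))%N by apply: leq_trans kN (p_homo _ _ _); exact: leq_maxr.
have /pleE/(_ k)[m] := un _ (leq_maxl n N).
by rewrite -(approx_le A1 (uB _) kM); exists m.
Qed.

(** Phrased with inclusion of basic sets rather than [ple], because inclusion is what A.3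
    delivers. *)
Definition base_monotone (P : AR T -> pt T -> Prop) : Prop :=
  forall t C D, nbase t D `<=` nbase t C -> P t C -> P t D.

Definition dense_below (P : AR T -> pt T -> Prop) s A : Prop :=
  forall t C, init_ar s t -> ple C A -> nbase t C !=set0 ->
    exists2 D, nbase t C D & P t D.

(** By A.2 only finitely many [t] have depth [n] in [C]; they are served one after the other, each
    time without changing the approximation of length [n]. *)
Lemma fusion_step P s A n C : base_monotone P -> dense_below P s A -> ple C A ->
  exists D, [/\ ple D C, approx D n = approx C n &
    forall t, init_ar s t -> depth_eq lefin C t n -> P t D].
Proof.
move=> Pmono Pdense CA.
have /(@finite_seqP {classic AR T})[l lE] : finite_set [set t | lefin t (approx C n)].
  by case: A2.
suff [D [DC DCn DP]] : exists D, [/\ ple D C, approx D n = approx C n &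
    forall t : {classic AR T}, t \in l -> init_ar s t -> depth_eq lefin C t n -> P t D].
  exists D; split=> // t st tC; apply: DP => //.
  by have : [set` l] t by rewrite -lE; case: tC.
elim: l {lE} => [|t l [D [DC DCn DP]]].
  by exists C; split=> //; exact: ple_refl.
have [[st tC]|not_t] := pselect (init_ar s t /\ depth_eq lefin C t n); last first.
  exists D; split=> // t'; rewrite inE => /orP[/eqP->|]; last exact: DP.
  by move=> ? ?; case: not_t.
have tD := depth_eq_agree DCn tC.
have [E [tE ED] PE] := Pdense t D st (ple_trans DC CA)
  (depth_nbase tD (nbase_refl (ex_intro _ n erefl))).
(* [E] satisfies [P t] but may disagree with [D] before length [n]; A.3 trades it for a [D'] that
   agrees with [D] and whose basic set at [t] is no larger. *)
have [D' [D'Dn D'D] [_ sub]] := (A3 tD).2 E ED (ex_intro _ E (nbase_refl tE)).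
exists D'; split.
- exact: ple_trans D'D DC.
- by rewrite -DCn; exact: init_ptE D'Dn.
move=> t'; rewrite inE => /orP[/eqP-> _ _|t'l st' t'C].
  exact: Pmono sub PE.
by apply: Pmono (DP t' t'l st' t'C); exact: nbase_sub.
Qed.

(** With [d] the depth of [s], stage [n] serves the extensions of [s] of depth [d + n] and then
    freezes that length. Every relevant [t] is served at the stage given by its depth, and
    monotonicity carries [P t] down to the limit. *)
Lemma fusion P s A : base_monotone P -> dense_below P s A -> nbase s A !=set0 ->
  exists2 B, nbase s A B &
    forall t, init_ar s t -> nbase t B !=set0 -> P t B.
Proof.
move=> Pmono Pdense [A0 [sA0 A0A]].
have [d sd] : exists d, depth_eq lefin A0 s d.
  by apply: nbase_depth; exists A0; exact: nbase_refl.
have /choice[F FP] (nC : nat * pt T) : exists D, ple nC.2 A ->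
    [/\ ple D nC.2, approx D nC.1 = approx nC.2 nC.1 &
    forall t, init_ar s t -> depth_eq lefin nC.2 t nC.1 -> P t D].
  have [CA|nCA] := pselect (ple nC.2 A); last by exists nC.2.
  by have [D] := fusion_step nC.1 Pmono Pdense CA; exists D.
pose u := fix u n := if n is n'.+1 then F ((d + n')%N, u n') else A0.
have uA n : ple (u n) A.
  elim: n => // n uA; have [DC _ _] := FP ((d + n)%N, u n) uA.
  exact: ple_trans DC uA.
have uP n : [/\ ple (u n.+1) (u n), approx (u n.+1) (d + n) = approx (u n) (d + n) &
    forall t, init_ar s t -> depth_eq lefin (u n) t (d + n) -> P t (u n.+1)].
  exact: (FP ((d + n)%N, u n) (uA n)).
have p_homo : {homo addn d : m n / (m <= n)%N} by move=> m n; rewrite leq_add2l.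
have p_unb k : exists n, (k <= d + n)%N by exists k; rewrite leq_addl.
have [B BP] := approx_fusion A1 clT p_homo p_unb (fun n => let: And3 _ h _ := uP n in h).
have Bu := ple_fusion p_homo p_unb (fun n => let: And3 h _ _ := uP n in h) BP.
have BA0 : approx B d = approx A0 d by have := BP 0; rewrite addn0.
(* Freezing length [d] preserves the depth of [s], but does not by itself make [s] an initial
   segment of [B]; A.3 provides a point below [B] that has this property. *)
have [B' [sB' B'B]] : nbase s B !=set0.
  by apply: depth_nbase sd _; split; [exists d|exact: Bu 0].
exists B'; first by split=> //; apply: ple_trans B'B (ple_trans (Bu 0) A0A).
move=> t st [C tC]; have [n tn] : exists n, depth_eq lefin B t n.
  by apply: nbase_depth; exists C; exact: nbase_sub tC.
(* By A.2 the segment [s] is [lefin]-below an initial segment of [approx B n]. If [n < d], this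
   would also be an approximation of [A0], against the minimality of [d]. *)
have dn : (d <= n)%N.
  case: (A2) => _ _ _ /(_ _ _ _ st tn.1)[_ /(init_arE A1)[i lein ->] si].
  rewrite leqNgt; apply/negP => nd.
  have /sd.2 : lefin s (approx A0 i).
    by rewrite -(approx_le A1 BA0) // (leq_trans lein) // ltnW.
  by rewrite leqNgt (leq_ltn_trans lein nd).
have [_ _ /(_ t st)] := uP (n - d)%N; rewrite subnKC // => Pu.
apply: (Pmono _ (u (n - d).+1)); first exact/nbase_sub/(ple_trans B'B)/Bu.
by apply: Pu; apply: depth_eq_agree tn; have := BP (n - d)%N; rewrite subnKC.
Qed.

(* Combinatorial forcing, with [Acc t D] read as: [D] accepts [t]. *)
Lemma forcing_dichotomy (Acc : AR T -> pt T -> Prop) s A :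
  base_monotone Acc -> nbase s A !=set0 ->
  exists2 B, nbase s A B &
    (forall C, nbase s B C -> exists t, [/\ init_ar s t, init_pt t C & Acc t B]) \/
    (forall t D, init_ar s t -> nbase t D !=set0 -> nbase t D `<=` nbase t B ->
      ~ Acc t D).
Proof.
move=> Amono sA.
(* [good]: every point of the basic set passes through an accepted extension of [t]. [bad]: no
   smaller non-empty basic set at [t] is good. A first fusion makes every [t] good or bad for
   [B0]. *)
pose good t D := forall C, nbase t D C ->
  exists v, [/\ init_ar t v, init_pt v C & Acc v D].
pose bad t D := forall E, nbase t E !=set0 -> nbase t E `<=` nbase t D -> ~ good t E.
have goodmono : base_monotone good.
  move=> t C D DC gC E ED; have [v [tv vE aC]] := gC E (DC _ ED).
  exists v; split=> //; apply: Amono aC => F [vF FD]; split=> //.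
  by apply: (DC F _).2; split=> //; exact: init_ar_pt vF.
have badmono : base_monotone bad.
  by move=> t C D DC bC E E0 ED; apply: bC => //; exact: subset_trans DC.
have [|t C st CA [C0 tC0]|B0 [sB0 B0A] B0P] := @fusion (fun t D => good t D \/ bad t D) s A _ _ sA.
- by move=> t C D DC [g|b]; [left; exact: goodmono g|right; exact: badmono b].
- have [b|] := pselect (bad t C).
    by exists C0 => //; right; apply: badmono b; exact/nbase_sub/tC0.2.
  move=> /existsNP[E /not_implyP[[D tD] /not_implyP[EC /contrapT gE]]].
  exists D; first exact: EC.
  by left; apply: goodmono gE; exact/nbase_sub/tD.2.
have [g|b] := B0P s (init_ar_refl sB0) (ex_intro _ B0 (nbase_refl sB0)).
  by exists B0 => //; left.
(* A second fusion makes badness pass to one-step extensions. Badness is measured against the fixed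
   [B0], while [D] only restricts the admissible extensions; this keeps the predicate monotone. *)
have [t C D DC h E k tE ED bt|t C st CB0 [C0 [tC0 C0C]]|B [sB BB0] BP] := @fusion
  (fun t D => forall E k, t = approx E k -> ple E D -> bad t B0 ->
    bad (approx E k.+1) B0) s B0 _ _ (ex_intro _ B0 (nbase_refl sB0)).
- by apply: h => //; apply: (DC E _).2; split=> //; exists k.
- have C0B0 := ple_trans C0C CB0.
  have [bt|] := pselect (bad t B0); last by exists C0.
  have [n tn] : exists n, depth_eq lefin C0 t n.
    by apply: nbase_depth; exists C0; exact: nbase_refl.
  have [k tk] := tC0.
  have [||A' A'C0 A'O] := @A4 C0 t n k [set v | AR_n k.+1 v /\ good v B0] tn.
  + by exists C0.
  + by move=> v [].
  have [D [tD DA']] := depth_nbase tn A'C0.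
  have DC0 := ple_trans DA' A'C0.2.
  exists D; first by split=> //; exact: ple_trans DC0 C0C.
  move=> E k' tE ED _.
  have k'k : k' = k by move: tE; rewrite tk => /(approx_inj A1)[].
  move: k'k tE => -> tE {k'}.
  case: A'O => [A'O|/disjoints_subset A'O].
    (* If all one-step extensions below [A'] were good, then [t] would be good for [D],
       contradicting its badness. *)
    exfalso; apply: (bt D); first by exists D; exact: nbase_refl.
      exact/nbase_sub/(ple_trans DC0).
    move=> G [tG GD].
    have Gk : approx G k = t by rewrite tk; apply: init_ptE; rewrite -?tk.
    have [|_ gG] := A'O (approx G k.+1).
      by exists G => //; split=> //; exact: ple_trans GD DA'.
    have [|v [Gv vG aG]] := gG G.
      split; first by exists k.+1.
      exact: ple_trans GD (ple_trans DC0 C0B0).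
    exists v; split=> //.
      by apply: init_ar_trans Gv => //; rewrite -Gk; exact: init_ar_approx.
    by apply: Amono aG; exact/nbase_sub/(ple_trans DC0).
  have EB0 := ple_trans ED (ple_trans DC0 C0B0).
  (* In the other case of A.4 the extension is not good, hence it is bad, since [B0] decides it. *)
  have [||g|//] := B0P (approx E k.+1).
  + by apply: init_ar_trans st _ => //; rewrite tE; exact: init_ar_approx.
  + by exists E; split=> //; exists k.+1.
  exfalso; apply: (A'O (approx E k.+1)); last by split=> //; exists E.
  exists E => //; split; last exact: ple_trans ED DA'.
  by exists k.
exists B; first by split=> //; exact: ple_trans BB0 B0A.
right => t D st [C tC] DB aD.
have [[j tj] CB] := DB C tC.
(* A [D] accepting [t] would make [t] good through [t] itself. Badness of [t] is then reached from
   that of [s] by climbing along [C]. *)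
suff bt : bad t B0.
  apply: (bt D); first by exists C.
    exact: subset_trans DB (nbase_sub BB0).
  by move=> E [tE ED]; exists t; split=> //; exact: init_ar_refl tE.
have [i ij si] : exists2 i, (i <= j)%N & s = approx C i.
  by apply: init_arE => //; rewrite -tj.
rewrite tj -(subnK ij); elim: (j - i)%N => [|k ih]; first by rewrite -si.
rewrite addSn; apply: (BP (approx C (k + i))) => //.
  by rewrite si; apply: init_ar_approx; rewrite leq_addl.
by exists C; split=> //; exists (k + i)%N.
Qed.

(** Acceptance means missing [branches X]. If it never occurs, every long enough approximation of a
    point [C] in the basic set is shared with a branch, so all approximations of [C] lie in [X]. *)
Lemma branches_ramsey (X : set (AR T)) s A : nbase s A !=set0 ->
  exists2 B, nbase s A B &
    nbase s B `<=` branches X \/ nbase s B `&` branches X = set0.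
Proof.
move=> /(@forcing_dichotomy (fun t D => nbase t D `&` branches X = set0))[].
  by move=> t C D DC; apply: subsetI_eq0.
move=> B sAB [h|h]; exists B => //; [right|left].
  apply/disjoints_subset => C sC XC.
  have [t [st tC /disjoints_subset/(_ C)]] := h C sC.
  by apply=> //; split=> //; exact: sC.2.
move=> C [[i si] CB] k.
have tC : nbase (approx C (maxn i k)) B C by split=> //; exists (maxn i k).
have /eqP/set0P[D [[tD DB] XD]] :=
  h (approx C (maxn i k)) B (ltac:(rewrite si; apply: init_ar_approx; exact: leq_maxl))
    (ex_intro _ C tC) (@subset_refl _ _).
by rewrite -(approx_le A1 (init_ptE A1 tD) (leq_maxr i k)).
Qed.

(** Acceptance means being contained in the union. If it never occurs, no basic set fits inside a
    single [branches (X n)], so each of these can be avoided by shrinking; a fusion avoids all of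
    them. *)
Lemma bigcup_branches_ramsey (X : nat -> set (AR T)) s A : nbase s A !=set0 ->
  exists2 B, nbase s A B &
    nbase s B `<=` \bigcup_n branches (X n) \/
    nbase s B `&` \bigcup_n branches (X n) = set0.
Proof.
move=> /(@forcing_dichotomy (fun t D => nbase t D `<=` \bigcup_n branches (X n)))[].
  by move=> t C D DC; exact: subset_trans.
move=> B0 [sB0 B0A] [h|h].
  exists B0 => //; left => C sC; have [t [_ tC]] := h C sC; apply.
  by split=> //; exact: sC.2.
(* At a segment of length [i] only the finitely many [X n] with [n <= i] are avoided; each [n] gets
   its turn on long enough segments. *)
have [t C D DC P n i E tE ni ED|t C st CB0 [C0 tC0]|B [sB BB0] BP] := @fusion
  (fun t D => forall n i C, t = approx C i -> (n <= i)%N -> ple C D ->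
    ~ branches (X n) C) s B0 _ _ (ex_intro _ B0 (nbase_refl sB0)).
- by apply: (P n i) => //; apply: (DC E _).2; split=> //; exists i.
- have [i ti] := tC0.1.
  suff [D tD DX] : exists2 D, nbase t C D &
      forall n, (n < i.+1)%N -> nbase t D `&` branches (X n) = set0.
    exists D => // n j E tE nj ED XE.
    have ji : j = i by move: tE; rewrite ti => /(approx_inj A1)[].
    have /disjoints_subset/(_ E) : nbase t D `&` branches (X n) = set0.
      by apply: DX; rewrite ltnS -ji.
    by apply=> //; split=> //; exists j.
  elim: i.+1 => [|n [D tD DX]]; first by exists C0.
  have [D' tD' D'X] := branches_ramsey (X n) (ex_intro _ D (nbase_refl tD.1)).
  have D'C := ple_trans tD'.2 tD.2.
  exists D'; first by split=> //; exact: tD'.1.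
  move=> m; rewrite ltnS leq_eqVlt => /orP[/eqP->|mn]; last first.
    by apply: subsetI_eq0 (DX m mn) => //; exact/nbase_sub/tD'.2.
  case: D'X => // D'X; exfalso; apply: (h t D' st).
  + by exists D'; exact/nbase_refl/tD'.1.
  + exact/nbase_sub/(ple_trans D'C).
  + by move=> E /D'X XE; exists n.
exists B; first by split=> //; exact: ple_trans BB0 B0A.
right; apply/disjoints_subset => C [[i si] CB] [n _ XC].
apply: (BP (approx C (maxn i n)) _ _ n (maxn i n) C) => //.
- by rewrite si; apply: init_ar_approx; exact: leq_maxl.
- by exists C; split=> //; exists (maxn i n).
- exact: leq_maxr.
Qed.

End Ramsey.

(** * The upper bound *)

Section UpperBound.
Variable T : approx_triple.
Variable lefin : AR T -> AR T -> Prop.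
Hypothesis A1 : axiom_A1 T.
Hypothesis clT : closed_in_AR_omega T.
Hypothesis A2 : axiom_A2 lefin.
Hypothesis A3 : axiom_A3 lefin.
Hypothesis A4 : axiom_A4 lefin.
Variable e : nat * AR T -> nat.
Hypothesis e_inj : injective e.
Implicit Types (A B : pt T) (s t : AR T).

(** Where the set is positive, the Ramsey property of its complement leaves only the alternative of
    containing a basic set. The form [nbase_n k A] makes that set non-empty automatically and
    codable by a point and a number. *)
Lemma positive_codesP x : positive_codes e x <->
  (forall n, is_tree (coded_seq e x n)) /\
  exists A k, forall B, nbase_n k A B ->
    forall n, ~ branches (coded_seq e x n) B.
Proof.
split=> [pos|[tr [A [k AkG]]]].
  have tr : forall n, is_tree (coded_seq e x n).
    apply: contrapT => ntr; apply: pos => s A [B sB].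
    by exists B => //; rewrite /coded_Gdelta asboolF // setI0.
  split=> //; move: pos; rewrite /positive_codes /= /coded_Gdelta asboolT //.
  move=> /existsNP[s /existsNP[A /not_implyP[sA /forall2NP sG]]].
  have [B sAB [BU|/disjoints_subset BG]] :=
    bigcup_branches_ramsey A1 clT A2 A3 A4 (coded_seq e x) sA.
    have [//|] := sG B; case.
    by rewrite setIC; apply/disjoints_subset/subsetC.
  have [k sk] := sAB.1; exists B, k => C; rewrite /nbase_n -sk => sC n XC.
  by apply: (BG C) => //; exists n.
rewrite /positive_codes /= /coded_Gdelta asboolT // => /(_ (approx A k) A)[].
  by exists A; apply: nbase_refl; exists k.
move=> B kB /disjoints_subset/(_ B); case.
  exact/nbase_refl/kB.1.
by move=> [n _]; exact: AkG.
Qed.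

(** Fixing the first argument of [e] numbers [AR T] injectively, which turns points into elements of
    Baire space. *)
Let code s : nat := e (0, s).

Let code_inj : injective code.
Proof. by move=> s t /e_inj[]. Qed.

(** Entry 0 of [y] is reserved for the length [k] of the basic set [nbase_n k A]. *)
Definition codes_point (y : nat -> nat) A : Prop :=
  forall i, y i.+1 = code (approx A i).

Definition witness_space : topologicalType :=
  ((cantor_space * baire_space) * baire_space)%type.

Let X (q : witness_space) : nat -> bool := q.1.1.
Let Y (q : witness_space) : nat -> nat := q.1.2.
Let Z (q : witness_space) : nat -> nat := q.2.

Let lcX i : locally_constant (fun q => X q i).
Proof.
apply: (@locally_constant_continuous_comp _ _ _ (fun x : cantor_space => x i)
  (fun q : witness_space => q.1.1)); last exact: locally_constant_coord.
by move=> q; apply: (cvg_comp _ _ (cvg_fst (F := nbhs q.1) (G := nbhs q.2)));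
  exact: cvg_fst.
Qed.

Let lcY i : locally_constant (fun q => Y q i).
Proof.
apply: (@locally_constant_continuous_comp _ _ _ (fun x : baire_space => x i)
  (fun q : witness_space => q.1.2)); last exact: locally_constant_coord.
by move=> q; apply: (cvg_comp _ _ (cvg_fst (F := nbhs q.1) (G := nbhs q.2)));
  exact: cvg_snd.
Qed.

Let lcZ i : locally_constant (fun q => Z q i).
Proof.
apply: (@locally_constant_continuous_comp _ _ _ (fun x : baire_space => x i)
  (fun q : witness_space => q.2)); last exact: locally_constant_coord.
by move=> q; exact: cvg_snd.
Qed.

(* The three ways in which (x, y) can fail to code a basic set inside G_x: y
   does not code a point, x does not code a sequence of trees, or some B in
   the basic set is a branch of some X_n; the even and odd entries of z then
   code B and a witness of B <= A. *)
Let no_point q := ~ exists A, forall i, (i < Z q 1)%N -> Y q i.+1 = code (approx A i).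

Let no_tree q := (exists n s t, [/\ Z q 1 = e (n, s), Z q 2 = e (n, t) & init_ar s t])
  /\ (X q (Z q 2) = true /\ X q (Z q 1) <> true).

(** [Z q 1] is the number of the tree, and the last clause compares [B] with [A] at length [Y q 0].
    A point is demanded only up to [i], so that finitely many coordinates are read. *)
Let has_branch i q := [/\
  exists B, forall j, (j < i)%N -> Z q j.*2.+2 = code (approx B j),
  exists a b, [/\ Z q i.*2.+2 = code a, Y q (Z q i.*2.+3).+1 = code b & lefin a b],
  exists2 a, Z q i.*2.+2 = code a & X q (e (Z q 1, a)) = true &
  Z q (Y q 0).*2.+2 = Y q (Y q 0).+1].

Let failure i q :=
  match Z q 0 with 0 => no_point q | 1 => no_tree q | _ => has_branch i q end.

Let lc_no_point : locally_constant no_point.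
Proof.
apply: (@locally_constant_dep _ _ _ (fun u q =>
  ~ exists A, forall i, (i < u)%N -> Y q i.+1 = code (approx A i)) (fun q => Z q 1)) => // u.
apply: (@locally_constant_prefix _ _ _ (fun q i => Y q i.+1)
  (fun a => ~ exists A, forall i, (i < u)%N -> a i = code (approx A i)) u) => // a b ab.
by congr (~ _); apply/propext; split=> -[A AP]; exists A => i iu;
  rewrite -AP // ab.
Qed.

Let lc_no_tree : locally_constant no_tree.
Proof.
apply: locally_constant_comp2; last apply: locally_constant_comp2.
- exact: (locally_constant_comp2 (fun u v => exists n s t,
    [/\ u = e (n, s), v = e (n, t) & init_ar s t])).
- apply: (locally_constant_comp (fun b => b = true)).
  exact: (locally_constant_dep (g := fun u q => X q u)).
apply: (locally_constant_comp (fun b => b <> true)).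
exact: (locally_constant_dep (g := fun u q => X q u)).
Qed.

Let lc_has_branch i : locally_constant (has_branch i).
Proof.
have -> : has_branch i = fun q =>
  (exists B, forall j, (j < i)%N -> Z q j.*2.+2 = code (approx B j)) /\
  ((exists a b, [/\ Z q i.*2.+2 = code a, Y q (Z q i.*2.+3).+1 = code b & lefin a b]) /\
  ((exists2 a, Z q i.*2.+2 = code a & X q (e (Z q 1, a)) = true) /\
  Z q (Y q 0).*2.+2 = Y q (Y q 0).+1)).
  by apply/funext => q; apply/propext; split=> [[]|[? [? []]]].
do 3?[apply: locally_constant_comp2].
- apply: (@locally_constant_prefix _ _ _ (fun q j => Z q j.*2.+2)
    (fun a => exists B, forall j, (j < i)%N -> a j = code (approx B j)) i) => // a b ab.
  by apply/propext; split=> -[A AP]; exists A => j ji; rewrite -AP // ab.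
- apply: (locally_constant_comp2 (fun u v => exists a b, [/\ u = code a, v = code b & lefin a b])) => //.
  exact: (locally_constant_dep (g := fun u q => Y q u.+1)).
- apply: (@locally_constant_dep _ _ _ (fun u q => exists2 a, u = code a & X q (e (Z q 1, a)) = true)
    (fun q => Z q i.*2.+2)) => // u.
  have [[a ->]|na] := pselect (exists a, u = code a); last first.
    suff -> : (fun q => exists2 a, u = code a & X q (e (Z q 1, a)) = true) =
        fun _ => False by exact: locally_constant_cst.
    by apply/funext => q; apply/propext; split=> // -[a ua]; case: na; exists a.
  have -> : (fun q => exists2 b, code a = code b & X q (e (Z q 1, b)) = true) =
      fun q => X q (e (Z q 1, a)) = true.
    apply/funext => q; apply/propext; split=> [[b /code_inj->//]|]; by exists a.
  apply: (locally_constant_comp (fun b => b = true)).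
  exact: (locally_constant_dep (g := fun u q => X q (e (u, a)))).
apply: (locally_constant_comp2 eq).
- exact: (locally_constant_dep (g := fun u q => Z q u.*2.+2)).
- exact: (locally_constant_dep (g := fun u q => Y q u.+1)).
Qed.

Let closed_failure : closed [set q | forall i, failure i q].
Proof.
apply: closed_forall_locally_constant => i.
apply: (@locally_constant_dep _ _ _ (fun u q => match u with
  0 => no_point q | 1 => no_tree q | _ => has_branch i q end) (fun q => Z q 0)) => //.
by case=> [|[|u]].
Qed.

(** Coding a point is a closed condition, so its failure shows at a finite stage, as [no_point]
    expects. *)
Let codes_limit (y : nat -> nat) :
  (forall n, exists A, forall i, (i < n)%N -> y i = code (approx A i)) ->
  exists A, forall i, y i = code (approx A i).
Proof.
move=> lim.
have /choice[a aP] i : exists a, y i = code a.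
  by have [A /(_ i)] := lim i.+1; exists (approx A i); auto.
have [|A AP] := approx_limit (a := a) clT.
  move=> n; have [A AP] := lim n; exists A => i iin.
  by apply: code_inj; rewrite -AP // aP.
by exists A => i; rewrite AP aP.
Qed.

Lemma positive_codes_sigma12 : sigma12 (positive_codes e).
Proof.
exists [set p : cantor_space * baire_space |
  (forall n, is_tree (coded_seq e p.1 n)) /\
  exists A, codes_point p.2 A /\ forall B, nbase_n (p.2 0) A B ->
    forall n, ~ branches (coded_seq e p.1 n) B]; last first.
  apply/seteqP; split=> [x /positive_codesP[tr [A [k AkG]]]|_ [[x y] [tr [A [yA AG]]] <-]].
    exists (x, fun i => if i is j.+1 then code (approx A j) else k) => //=.
    by split=> //; exists A.
  by apply/positive_codesP; split=> //; exists A, (y 0).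
exists [set q | forall i, failure i q] => //.
apply/seteqP; split=> [[x y] /= nP|_ [[[x y] z] F <-] /= [tr [A [yA AG]]]]; last first.
  rewrite /= in F.
  have [z0|z0|[m z0]] : [\/ z 0 = 0, z 0 = 1 | exists m, z 0 = m.+2].
  - by case: (z 0) => [|[|m]]; [constructor 1|constructor 2|constructor 3; exists m].
  - have := F 0; rewrite /failure /Z /= z0; apply; exists A => i _; exact: yA.
  - have := F 0; rewrite /failure /Z /= z0 => -[[n [s [t [zs zt st]]]]].
    rewrite zs zt /X /= => -[xt]; apply.
    exact: (tr n s t st xt).
  have {}F i : has_branch i ((x, y), z) by have := F i; rewrite /failure /Z /= z0.
  have [B zB] : exists B, forall i, z i.*2.+2 = code (approx B i).
    by apply: codes_limit => n; have [] := F n.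
  apply: (AG B _ (z 1)).
    split.
      have [_ _ _] := F 0; rewrite /Z /Y /= zB yA => /code_inj BA.
      by exists (y 0).
    case: A2 => _ _ pleE _; apply/pleE => n.
    have [_ [a [b [+ + ab]]] _ _] := F n.
    rewrite /Z /Y /= zB yA => /code_inj an /code_inj bn; exists (z n.*2.+3).
    by rewrite an bn.
  move=> n; have [_ _ [a + + _]] := F n.
  by rewrite /Z /X /= zB => /code_inj ->.
have [tr|/existsNP[n /existsNP[s /existsNP[t /not_implyP[st /not_implyP[xt xs]]]]]] :=
  pselect (forall n, is_tree (coded_seq e x n)); last first.
  exists ((x, y), fun i => match i with 0 => 1 | 1 => e (n, s) | _ => e (n, t) end) => //= i.
  by split=> //; exists n, s, t.
have [[A yA]|noA] := pselect (exists A, codes_point y A); last first.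
  have [N nN] : exists N, ~ exists A, forall i, (i < N)%N -> y i.+1 = code (approx A i).
    by apply/existsNP => h; apply: noA; apply: (codes_limit (y := fun i => y i.+1)).
  by exists ((x, y), fun i => if i is 0 then 0 else N).
have [B [AB [n Bn]]] : exists B, nbase_n (y 0) A B /\ exists n, branches (coded_seq e x n) B.
  apply: contrapT => nB; apply: nP; split=> //; exists A; split=> // B AB n Bn.
  by apply: nB; exists B; split=> //; exists n.
have /choice[f fP] k : exists m, lefin (approx B k) (approx A m).
  by case: A2 => _ _ pleE _; apply: (pleE B A).1 => //; exact: AB.2.
pose z i := match i with 0 => 2 | 1 => n | j.+2 => if odd j then f j./2 else code (approx B j./2) end.
have zB i : z i.*2.+2 = code (approx B i) by rewrite /z odd_double doubleK.
have zf i : z i.*2.+3 = f i by rewrite /z /= odd_double /= uphalf_double.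
have [z0 z1] : z 0 = 2 /\ z 1 = n by [].
exists ((x, y), z) => // i; move: z0 z1 zB zf; clearbody z => z0 z1 zB zf.
rewrite /failure [Z _ 0]z0; split.
- by exists B => j _; exact: zB.
- by exists (approx B i), (approx A (f i)); rewrite /Y /Z /= zf yA.
- by exists (approx B i); [exact: zB|rewrite /Z /= z1; exact: Bn].
by rewrite /Z /Y /= zB yA; congr code; apply: init_ptE AB.1.
Qed.

End UpperBound.

(** * The reduction *)

Section Thinning.
Variable T : approx_triple.
Variable lefin : AR T -> AR T -> Prop.
Hypothesis A1 : axiom_A1 T.
Hypothesis clT : closed_in_AR_omega T.
Hypothesis A2 : axiom_A2 lefin.
Variable m : AR T -> nat.
Hypothesis m_homo : forall s t, init_ar s t -> (m s <= m t)%N.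
Hypothesis ellbar_infinite : forall A, infinite_set (ellbar m A).
Hypothesis remove_one : forall s (A : pt T) (B' : set nat), init_pt s A ->
  ellentuck (ell m s) (ellbar m A) B' ->
  (exists k, ellbar m A `\` B' = [set k]) ->
  exists2 B, nbase s A B & ellbar m B = B'.
Implicit Types (A B C : pt T) (s t : AR T).

Lemma emp_approx A i : emp <> approx A i <-> (0 < i)%N.
Proof.
case: (A1) => A0 _ _; rewrite -(A0 A); split=> [|i0 /(approx_inj A1)[]].
  by case: i.
by move=> i0'; rewrite -i0' in i0.
Qed.

Lemma ellP A n k : ell m (approx A n) k <->
  exists2 i, (i < n)%N & k = m (approx A i.+1).
Proof.
split=> [[t [et /(init_arE A1)[i lin ti]] <-]|[i lin ->]].
  move: et; rewrite ti => /emp_approx.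
  by case: i lin ti => // i lin ti _; exists i.
exists (approx A i.+1) => //; split; first exact/emp_approx.
exact: init_ar_approx.
Qed.

Lemma ellbarP A k : ellbar m A k <-> exists i, k = m (approx A i.+1).
Proof.
split=> [[t [et [i ti]] <-]|[i ->]].
  move: et; rewrite ti => /emp_approx.
  by case: i ti => // i ti _; exists i.
exists (approx A i.+1) => //; split; first exact/emp_approx.
by exists i.+1.
Qed.

Lemma ell_ellbar s A : init_pt s A -> ell m s `<=` ellbar m A.
Proof.
by move=> [n ->] k /ellP[i _ ->]; apply/ellbarP; exists i.
Qed.

Lemma m_approx A i j : (i <= j)%N -> (m (approx A i) <= m (approx A j))%N.
Proof. by move=> ij; exact/m_homo/init_ar_approx. Qed.

(** Along [A] the index is nondecreasing and unbounded, so the values below [n] occupy an initial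
    segment. The shift skips the empty approximation, which contributes no index. *)
Lemma cut_ex A n : exists l, forall i, (i < l)%N = (m (approx A i.+1) < n)%N.
Proof.
have [l lP lmin] : exists2 l, (n <= m (approx A l.+1))%N &
    forall i, (n <= m (approx A i.+1))%N -> (l <= i)%N.
  have [|l lP lmin] := @ex_minnP (fun i => n <= m (approx A i.+1))%N; last by exists l.
  have [_ /ellbarP[i ->]] := (infinite_natP _).1 (@ellbar_infinite A) n.
  by exists i.
exists l => i; apply/idP/idP => [il|].
  by rewrite ltnNge; apply: contraL il => /lmin; rewrite -leqNgt.
apply: contraLR; rewrite -!leqNgt => li.
by apply: leq_trans lP (m_approx _ _).
Qed.

(* Deleting the unwanted elements of [ellbar m A] one at a time, in increasing
   order, fixes longer and longer approximations, so the process has a limit. *)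
Lemma thinning s A (B' : set nat) : init_pt s A ->
  ellentuck (ell m s) (ellbar m A) B' ->
  exists2 C, nbase s A C & ellbar m C = B'.
Proof.
move=> [j sj] [B'inf [sB' _] B'A].
have [len lenP] : exists len : pt T -> nat -> nat,
    forall C n i, (i < len C n)%N = (m (approx C i.+1) < n)%N.
  have /choice[len lenP] (Cn : pt T * nat) := cut_ex Cn.1 Cn.2.
  by exists (fun C n => len (C, n)) => C n i; exact: (lenP (C, n)).
(* The index set at stage [n]: the unwanted indices below [n] are gone, those from [n] on are still
   there. *)
pose upto n : set nat := [set k | ellbar m A k /\ ((k < n)%N -> B' k)].
have step (nC : nat * pt T) : exists D, ellbar m nC.2 = upto nC.1 ->
    nbase_n (len nC.2 nC.1) nC.2 D /\ ellbar m D = upto nC.1.+1.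
  case: nC => n C /=; have [Cn|] := pselect (ellbar m C = upto n); last by exists C.
  have [[An nB']|nAn] := pselect (ellbar m A n /\ ~ B' n); last first.
    exists C => _; split; first by apply: nbase_refl; exists (len C n).
    rewrite Cn; apply/seteqP; split=> k [Ak kB']; split=> //.
      rewrite ltnS leq_eqVlt => /orP[/eqP kn|]; last exact: kB'.
      by apply: contrapT => nB'k; apply: nAn; rewrite -kn.
    by move=> kn; apply: kB'; exact: ltnW.
  (* The approximation of length [len C n] has only indices below [n], so it can be retained while
     [n] is deleted. *)
  have [|||D CD DC] := @remove_one (approx C (len C n)) C (ellbar m C `\ n).
  - by exists (len C n).
  - split; last by move=> k [].
      by apply: infinite_setD => //; exact: finite_set1.
    split=> [k /ellP[i]|i k /ellP[i' + ->] [/ellbarP[k' ->] _]].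
      rewrite lenP => kn ->; split; first by apply/ellbarP; exists i.
      by move=> kn'; rewrite kn' ltnn in kn.
    rewrite lenP => i'n k'i'; apply/ellP; exists k' => //.
    by rewrite lenP (leq_ltn_trans k'i').
  - exists n; rewrite Cn; apply/seteqP; split=> [k [Ck nCk]|_ ->].
      by apply: contrapT => kn; apply: nCk.
    by split=> [|[_]]; [split; rewrite ?ltnn|apply].
  exists D => _; split=> //; rewrite DC Cn; apply/seteqP; split=> k.
    move=> [[Ak kB'] kn]; split=> //.
    by rewrite ltnS leq_eqVlt => /orP[/eqP|]; [|exact: kB'].
  move=> [Ak kB']; split; first by split=> // kn; apply: kB'; exact: ltnW.
  by move=> kn; apply: nB'; rewrite -kn; apply: kB'; rewrite kn.
have [F FP] := choice step.
(* The start must already freeze [s]. Every index of [A] up to [m s] lies in [ell m s], hence in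
   [B'], so nothing before [(m s).+1] needs deletion; for the empty [s] the process starts at 0. *)
have [n0 n0A n0s] : exists2 n0, ellbar m A = upto n0 & (j <= len A n0)%N.
  case: j sj => [_|j sj]; first by exists 0 => //; apply/seteqP; split=> k // [].
  exists (m s).+1; last by rewrite lenP -sj.
  apply/seteqP; split=> [k|k []//] /[dup] Ak /ellbarP[i ki]; split=> //.
  rewrite ltnS => ks; apply: sB'; rewrite sj; apply/ellP.
  have [ij|ji] := leqP i j; first by exists i.
  exists j => //; apply/eqP; rewrite eqn_leq -sj ks sj ki; apply: m_approx.
  exact: ltnW.
pose u := fix u n := if n is n'.+1 then F ((n0 + n')%N, u n') else A.
have uE n : ellbar m (u n) = upto (n0 + n)%N.
  elim: n => [|n ih]; first by rewrite addn0.
  by rewrite addnS; exact: (FP ((n0 + n)%N, u n) ih).2.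
pose p n := len (u n) (n0 + n)%N.
have uS n : nbase_n (p n) (u n) (u n.+1) := (FP ((n0 + n)%N, u n) (uE n)).1.
have uS_approx n : approx (u n.+1) (p n) = approx (u n) (p n) := init_ptE A1 (uS n).1.
have p_homo : {homo p : a b / (a <= b)%N}.
  apply: (homo_leq leqnn leq_trans) => n.
  case pn: (p n) => [//|l]; have lp : (l < p n)%N by rewrite pn.
  rewrite /p lenP (approx_le A1 (uS_approx n)) // addnS ltnS ltnW //.
  by rewrite -lenP.
have agree n n' i : (n <= n')%N -> (i <= p n)%N -> approx (u n') i = approx (u n) i.
  move=> /subnK <-; elim: (n' - n)%N => // k ih ipn; rewrite addSn -ih //.
  apply: approx_le (uS_approx _) _ => //.
  by apply: leq_trans ipn _; apply: p_homo; rewrite leq_addl.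
have B'p k n : B' k -> (k < n0 + n)%N ->
    exists2 i, (i < p n)%N & k = m (approx (u n) i.+1).
  move=> B'k kn; have /ellbarP[i ki] : ellbar m (u n) k.
    by rewrite uE; split=> //; exact: B'A.
  by exists i => //; rewrite lenP -ki.
have p_unb k : exists n, (k <= p n)%N.
  elim: k => [|k [n kn]]; first by exists 0.
  have [b B'b nb] := (infinite_natP _).1 B'inf (n0 + n)%N.
  exists b.+1; have [|i ip bi] := B'p b b.+1 B'b.
    by rewrite addnS ltnS leq_addl.
  apply: leq_ltn_trans ip; rewrite leqNgt; apply/negP => ik.
  have nb' : (n <= b.+1)%N.
    by apply: leq_trans (leq_addl n0 n) (leq_trans nb (leqnSn b)).
  have ipn : (i < p n)%N := leq_trans ik kn.
  move: nb; rewrite bi (agree _ _ _ nb') // leqNgt.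
  by move: ipn; rewrite lenP => ->.
have [C CP] := approx_fusion A1 clT p_homo p_unb uS_approx.
have Cu := ple_fusion A1 A2 p_homo p_unb (fun n => (uS n).2) CP.
exists C.
  split; last exact: Cu 0.
  exists j; rewrite sj (approx_le A1 (CP 0)) //.
  by rewrite /p addn0.
apply/seteqP; split=> [k /ellbarP[i ki]|k B'k].
  have [n ni] := p_unb i.+1.
  have /ellbarP : exists i', k = m (approx (u (maxn n k.+1)) i'.+1).
    exists i; rewrite {1}ki (approx_le A1 (CP (maxn n k.+1))) //.
    exact: leq_trans ni (p_homo _ _ (leq_maxl _ _)).
  rewrite uE => -[_]; apply.
  by apply: leq_trans (leq_maxr n k.+1) (leq_addl _ _).
have [|i ip ->] := B'p k k.+1 B'k; first by rewrite addnS ltnS leq_addl.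
by apply/ellbarP; exists i; rewrite (approx_le A1 (CP k.+1)).
Qed.

End Thinning.

(** * Chains of finite sequences *)

Definition extends (y : nat -> nat) (w : seq nat) : Prop :=
  forall i, (i < size w)%N -> nth 0 w i = y i.

Definition compatible (v w : seq nat) : Prop :=
  forall i, (i < size v)%N -> (i < size w)%N -> nth 0 v i = nth 0 w i.

Definition chain (sigma : nat -> seq nat) (S : set nat) : Prop :=
  forall k k', S k -> S k' -> compatible (sigma k) (sigma k').

Lemma extends_mkseq y n : extends y (mkseq y n).
Proof. by move=> i; rewrite size_mkseq => /(nth_mkseq _ _) ->. Qed.

Lemma extends_chain sigma y (S : set nat) :
  (forall k, S k -> extends y (sigma k)) -> chain sigma S.
Proof. by move=> Sy k k' Sk Sk' i ik ik'; rewrite (Sy k Sk) // (Sy k' Sk'). Qed.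

(** Compatible sequences of equal length coincide, so the length is injective on the chain. *)
Lemma chain_unbounded sigma (S : set nat) :
  {in S &, injective sigma} -> infinite_set S -> chain sigma S ->
  forall n, exists2 k, S k & (n <= size (sigma k))%N.
Proof.
move=> sinj Sinf Sch; have cinj : {in S &, injective (size \o sigma)}.
  move=> k k' Sk Sk' /= kk'; apply: sinj => //.
  apply: (@eq_from_nth _ 0) => // i ik.
  by apply: Sch; rewrite -?kk' //; exact: set_mem.
move=> n; have : infinite_set [set (size \o sigma) k | k in S].
  by rewrite (eq_finite_set (inj_card_eq cinj)).
by move=> /infinite_natP/(_ n)[_ [k Sk <-]]; exists k.
Qed.

Lemma chain_extends sigma (S : set nat) :
  {in S &, injective sigma} -> infinite_set S -> chain sigma S ->
  exists y, forall k, S k -> extends y (sigma k).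
Proof.
move=> sinj Sinf Sch.
have /choice[y yP] (i : nat) : exists j, exists2 k, S k &
    (i < size (sigma k))%N /\ nth 0 (sigma k) i = j.
  have [k Sk ik] := chain_unbounded sinj Sinf Sch i.+1.
  by exists (nth 0 (sigma k) i), k.
exists y => k Sk i ik; have [k' Sk' [ik' <-]] := yP i.
exact: Sch.
Qed.

Lemma infinite_enum_seq (E : set nat) : infinite_set E ->
  exists sigma : nat -> seq nat,
    {in E &, injective sigma} /\ forall w, exists2 k, E k & sigma k = w.
Proof.
move=> Einf.
have /pcard_eqP/bijPex[g [_ ginj gsurj]] : (E #= [set: nat])%card.
  exact: eq_card_nat (countableP _) Einf.
exists (CodeSeq.decode \o g); split.
  by move=> k k' Ek Ek' /= /(can_inj CodeSeq.decodeK); exact: ginj.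
move=> w; have [k Ek gk] := gsurj (CodeSeq.code w) I.
by exists k => //=; rewrite gk CodeSeq.codeK.
Qed.

Lemma clopen_locally_constant (X : topologicalType) (C : set X) :
  clopen C -> locally_constant C.
Proof.
move=> [oC cC] x; have [Cx|nCx] := pselect (C x).
  apply: (filterS _ (open_nbhs_nbhs (conj oC Cx))) => y Cy.
  by apply/propext.
apply: (filterS _ (open_nbhs_nbhs (conj (closed_openC cC) nCx))) => y nCy.
by apply/propext.
Qed.

(** * The reduction map, its continuity and its correctness *)

Section Reduction.
Variable T : approx_triple.
Variable lefin : AR T -> AR T -> Prop.
Hypothesis A1 : axiom_A1 T.
Hypothesis clT : closed_in_AR_omega T.
Hypothesis A2 : axiom_A2 lefin.
Hypothesis A3 : axiom_A3 lefin.
Hypothesis A4 : axiom_A4 lefin.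
Variable m : AR T -> nat.
Hypothesis m_homo : forall s t, init_ar s t -> (m s <= m t)%N.
Hypothesis ellbar_infinite : forall A, infinite_set (ellbar m A).
Hypothesis remove_one : forall s (A : pt T) (B' : set nat), init_pt s A ->
  ellentuck (ell m s) (ellbar m A) B' ->
  (exists k, ellbar m A `\` B' = [set k]) ->
  exists2 B, nbase s A B & ellbar m B = B'.
Variable Astar : pt T.
Hypothesis Astar_max : forall A, ellbar m A `<=` ellbar m Astar.
Hypothesis ellbar_homo : forall A B, ple B A -> ple A Astar ->
  ellbar m B `<=` ellbar m A.
Variable sigma : nat -> seq nat.
Hypothesis sigma_inj : {in ellbar m Astar &, injective sigma}.
Hypothesis sigma_surj : forall w, exists2 k, ellbar m Astar k & sigma k = w.
Variable e : nat * AR T -> nat.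
Hypothesis e_inj : injective e.
Variable X : topologicalType.
Variable U : nat -> set X.
Hypothesis U_clopen : forall i, clopen (U i).
Hypothesis U_base : forall x W, nbhs x W -> exists i, U i x /\ U i `<=` W.
Variable F : set ((X * baire_space) * baire_space).
Hypothesis F_closed : closed F.
Implicit Types (A B C : pt T) (s t : AR T).

(* The section at x of the tree of F, where theta i stands for [U i x]. *)
Definition section_tree (theta : nat -> Prop) (w : seq nat) (z : nat -> nat) : Prop :=
  forall i, (i < size w)%N -> theta i -> exists q : (X * baire_space) * baire_space,
    [/\ F q, U i q.1.1, extends q.1.2 w & forall j, (j < size w)%N -> q.2 j = z j].

(* The branches of [bad_tree theta N] are the points A for which either
   [ellbar m A] visibly fails to be a chain, or the section has a branch over
   the sequence coded by the chain which is dominated by [ellbar m A] past N. *)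
Definition bad_tree (theta : nat -> Prop) (N : nat) (t : AR T) : Prop :=
  (forall A n, t = approx A n -> (N <= n)%N -> ~ chain sigma (ell m (approx A N))) \/
  exists z : nat -> nat,
    (forall b b', ell m t b -> ell m t b' -> (b < b')%N -> (N <= b)%N ->
      forall i, (i <= b)%N -> (z i <= b')%N) /\
    (forall k, ell m t k -> section_tree theta (sigma k) z).

Definition reduction (x : X) : cantor_space :=
  fun k => `[< exists N t, k = e (N, t) /\ bad_tree (fun i => U i x) N t >].

Lemma coded_reduction x N : coded_seq e (reduction x) N = bad_tree (fun i => U i x) N.
Proof.
apply/seteqP; split=> t; rewrite /coded_seq /reduction /=.
  by move=> /asboolP[N' [t' [/e_inj[-> ->]]]].
by move=> tb; apply/asboolP; exists N, t.
Qed.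

Lemma ell_sub s t : init_ar s t -> ell m s `<=` ell m t.
Proof.
move=> st k [r [er rs] <-]; exists r => //; split=> //.
exact: init_ar_trans st.
Qed.

Lemma bad_tree_is_tree theta N : is_tree (bad_tree theta N).
Proof.
move=> s t st [tbad|[z [zb zT]]]; [left|right].
  have [B [i [j [ij si tj]]]] := st => A n sn Nn.
  have : approx B i = approx A n by rewrite -si.
  move=> /(approx_inj A1)[iEn BA]; rewrite -iEn in Nn.
  by rewrite -BA //; apply: (tbad B j) => //; exact: leq_trans ij.
exists z; split=> [b b' sb sb'|k sk]; first by apply: zb; exact: ell_sub st _ _.
by apply: zT; exact: ell_sub st _ _.
Qed.

Lemma ell_bounded t k : ell m t k -> (k <= m t)%N.
Proof. by move=> [r [_ rt] <-]; exact: m_homo. Qed.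

Lemma sigma_inj_ellbar A : {in ellbar m A &, injective sigma}.
Proof.
by move=> k k' /set_mem/Astar_max Ek /set_mem/Astar_max Ek'; apply: sigma_inj;
  exact: mem_set.
Qed.

Lemma continuous_reduction : continuous reduction.
Proof.
apply: locally_constant_continuous => k.
have lcU i : locally_constant (fun x => U i x) by exact: clopen_locally_constant.
have [[[N t] kE]|nk] := pselect (exists Nt, k = e Nt); last first.
  suff -> : (fun x => reduction x k) = fun _ => false by exact: locally_constant_cst.
  apply/funext => x; apply/asboolF => -[N [t [kE _]]].
  by apply: nk; exists (N, t).
have -> : (fun x => reduction x k) = fun x => `[< bad_tree (fun i => U i x) N t >].
  apply/funext => x; apply: asbool_equiv_eq; split=> [[N' [t' [+ bt]]]|].
    by rewrite kE => /e_inj[-> ->].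
  by exists N, t.
(* Indices in [ell m t] are at most [m t], so [M] bounds the lengths of the sequences involved and
   thereby every [i] for which [theta i] is consulted. *)
pose M := \max_(i < (m t).+1) size (sigma i).
apply: (@locally_constant_prefix _ _ _ (fun x i => U i x)
  (fun theta => `[< bad_tree theta N t >]) M) => // theta theta' thE.
suff sec z j : ell m t j -> section_tree theta (sigma j) z = section_tree theta' (sigma j) z.
  apply: asbool_equiv_eq; split=> -[|[z [zb zT]]]; try by left.
    by right; exists z; split=> // j tj; rewrite -sec //; exact: zT.
  by right; exists z; split=> // j tj; rewrite sec //; exact: zT.
move=> tj; have jM i : (i < size (sigma j))%N -> (i < M)%N.
  have jt : (j < (m t).+1)%N by rewrite ltnS; exact: ell_bounded.
  by move=> /leq_trans; apply; exact: (leq_bigmax (Ordinal jt)).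
by apply/propext; split=> h i ij thi; apply: h => //; rewrite ?thE ?jM // -thE ?jM.
Qed.

(** [Astar] is thinned until its indices enumerate initial segments of [y]. If some [C] below the
    result were a branch of a bad tree, the witnesses [z] of its levels would be eventually bounded
    in each coordinate, and a cluster point would lie in the section of the closed set [F]. *)
Lemma reduction_positive x y :
  (forall z, ~ F ((x, y), z)) -> positive_codes e (reduction x).
Proof.
move=> nF; apply/(positive_codesP A1 clT A2 A3 A4).
split=> [n|]; first by rewrite coded_reduction; exact: bad_tree_is_tree.
pose B' := [set k | ellbar m Astar k /\ extends y (sigma k)].
have B'inf : infinite_set B'.
  suff : infinite_set [set size (sigma k) | k in B'] by apply: contra_not; exact: finite_image.
  apply/infinite_natP => n; have [k Ek kn] := sigma_surj (mkseq y n).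
  by exists n => //; exists k; [split=> //|]; rewrite kn ?size_mkseq //; exact: extends_mkseq.
have [|A [_ AAstar] AB'] := thinning A1 clT A2 m_homo ellbar_infinite remove_one
    (s := approx Astar 0) (A := Astar) (B' := B') (ex_intro _ 0 erefl).
  split=> //; last by move=> k [].
  by split=> [k|i j] /(ellP A1)[].
exists A, 0 => C [_ CA] N; rewrite coded_reduction => Cbad.
have CB' : ellbar m C `<=` B' by rewrite -AB'; exact: ellbar_homo.
have Cch : chain sigma (ellbar m C).
  by apply: (extends_chain (y := y)) => k /CB'[].
have Cunb := chain_unbounded (@sigma_inj_ellbar C) (@ellbar_infinite C) Cch.
have /choice[z zP] (j : nat) : exists z : nat -> nat, (N <= j)%N ->
    (forall b b', ell m (approx C j) b -> ell m (approx C j) b' -> (b < b')%N ->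
      (N <= b)%N -> forall i, (i <= b)%N -> (z i <= b')%N) /\
    (forall k, ell m (approx C j) k -> section_tree (fun i => U i x) (sigma k) z).
  have [jN|Nj] := ltnP j N; first by exists id.
  have [|[z zP]] := Cbad j; last by exists z.
  move=> /(_ C j erefl Nj); case.
  have CN : ell m (approx C N) `<=` ellbar m C by apply: ell_ellbar => //; exists N.
  by move=> k k' /CN Ck /CN Ck'; exact: Cch.
have /choice[h hP] (i : nat) : exists h, exists n0, forall n, (n0 <= n)%N -> (z n i <= h)%N.
  (* Any two indices [b < b'] of [C] with [b] beyond [N] and [i] bound coordinate [i] by [b'], as
     soon as the level is high enough to contain both. *)
  have [b Cb Nib] := (infinite_natP _).1 (@ellbar_infinite C) (maxn N i).
  have [b' Cb' bb'] := (infinite_natP _).1 (@ellbar_infinite C) b.+1.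
  move: (Nib); rewrite geq_max => /andP[Nb ib].
  have /(ellbarP A1)[j1 bE] := Cb; have /(ellbarP A1)[j2 b'E] := Cb'.
  exists b', (maxn N (maxn j1.+1 j2.+1)) => n; rewrite !geq_max => /and3P[Nn j1n j2n].
  have [zb _] := zP n Nn; apply: (zb b b') => //; apply/(ellP A1).
    by exists j1.
  by exists j2.
have [w wP] := bounded_cluster hP.
apply: (nF w); apply: contrapT => nFw.
have [[V1 V3] /= [[[V2 V4] [/= nV2 nV4] V24] nV3] VF] : nbhs ((x, y), w : baire_space) (~` F).
  exact: open_nbhs_nbhs (conj (closed_openC F_closed) nFw).
have [i [Ux UV]] := U_base nV2.
have [n4 V4P] := nbhs_cylinder nV4; have [n3 V3P] := nbhs_cylinder nV3.
(* [sigma k] is taken long enough to consult [U i] and to fix all coordinates on which the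
   neighbourhood of [((x, y), w)] depends. *)
have [k Ck] := Cunb (maxn i.+1 (maxn n3 n4)); rewrite !geq_max => /and3P[ik n3k n4k].
have /(ellbarP A1)[j kj] := Ck.
have [n] := wP (size (sigma k)) (maxn N j.+1); rewrite geq_max => /andP[Nn jn] zw.
have [_ zT] := zP n Nn.
have [|q [Fq Uq qk qz]] := zT k _ i ik Ux; first by apply/(ellP A1); exists j.
apply: VF Fq; case: q Uq qk qz => [[x' y'] z'] /= Ux' y'k z'z.
have [_ yk] := CB' k Ck; split=> /=.
  apply: V24; split=> /=; first exact: UV.
  by apply: V4P => i' i'n; rewrite -y'k ?yk // (leq_trans i'n).
by apply: V3P => i' i'n; rewrite z'z ?zw // (leq_trans i'n).
Qed.

(** [A] itself avoids all bad trees, so its indices form a chain and determine [y]. A point [z] of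
    the section at [(x, y)] would be dominated after thinning [A], and the thinned point would be a
    branch of a bad tree. *)
Lemma positive_reduction x : positive_codes e (reduction x) ->
  exists y, forall z, ~ F ((x, y), z).
Proof.
move=> /(positive_codesP A1 clT A2 A3 A4)[_ [A [k Agood]]].
have {}Agood B N : nbase_n k A B -> ~ branches (bad_tree (fun i => U i x) N) B.
  by rewrite -coded_reduction => kB; exact: Agood.
have Ach : chain sigma (ellbar m A).
  move=> a b /(ellbarP A1)[i ai] /(ellbarP A1)[j bj]; apply: contrapT => ab.
  (* This length is large enough for both incompatible indices to be visible. *)
  apply: (Agood A (maxn i j).+1); first by apply: nbase_refl; exists k.
  move=> l; left => A' n /(approx_inj A1)[<- AA'] lN.
  rewrite -AA' // => /(_ a b) ch; apply/ab/ch; apply/(ellP A1).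
    by exists i => //; rewrite ltnS leq_maxl.
  by exists j => //; rewrite ltnS leq_maxr.
have [y yA] := chain_extends (@sigma_inj_ellbar A) (@ellbar_infinite A) Ach.
(* The stem [approx A k] must be kept. Its indices are all below [N], so domination is only required
   among the elements of the sparse set [S]. *)
exists y => z Fz; pose N := (m (approx A k)).+1.
have [|S [SA Sinf Ssparse]] := @sparse_subset (ellbar m A `\` `I_N) z.
  by apply: infinite_setD => //; exact: finite_II.
have sA : init_pt (approx A k) A by exists k.
have [|C AC CE] := thinning A1 clT A2 m_homo ellbar_infinite remove_one
    (s := approx A k) (A := A) (B' := ell m (approx A k) `|` S) sA.
  split.
  - exact: sub_infinite_set Sinf.
  - split=> [i|i j ik [//|/SA[_ /= /negP]]]; first by left.
    rewrite -leqNgt => Nj ji; have := leq_trans Nj (leq_trans ji (ell_bounded ik)).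
    by rewrite ltnn.
  - by move=> i [/(ell_ellbar A1 sA)//|/SA[]].
have CEl l i : ell m (approx C l) i -> (ell m (approx A k) `|` S) i.
  by rewrite -CE; apply: (ell_ellbar A1); exists l.
apply: (Agood C N AC) => l; right; exists z; split=> [b b' /CEl Cb /CEl Cb' bb' Nb i ib|j /CEl Cj].
  have inS c : (ell m (approx A k) `|` S) c -> (N <= c)%N -> S c.
    by move=> [/ell_bounded cN Nc|//]; move: Nc; rewrite /N ltnNge cN.
  apply: (Ssparse b b') => //; apply: inS => //.
  exact: leq_trans Nb (ltnW bb').
move=> i ij Ux; exists ((x, y), z); split=> //; apply: yA.
by case: Cj => [/(ell_ellbar A1 sA)//|/SA[]].
Qed.

End Reduction.

Theorem theorem1p1 (R : realType) (T : approx_triple)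
    (e : nat * AR T -> nat) :
  axioms_A1_A4 T ->
  countable [set: AR T] ->
  closed_in_AR_omega T ->
  well_indexed T ->
  bijective e ->
  sigma12_complete R (positive_codes e).
Proof.
move=> [A1 [lefin [A2 A3 A4]]] _ clT.
move=> [m [m_homo ellbar_inf [Astar [Astar_max ellbar_homo]] remove_one]].
move=> /bij_inj e_inj.
split; first exact (positive_codes_sigma12 A1 clT A2 A3 A4 e_inj).
move=> X [sepX _] clX B [P [F clF PF] ->].
have [U [U_clopen U_base]] := separable_countable_clopen_base sepX clX.
have [sigma [sigma_inj sigma_surj]] := infinite_enum_seq (ellbar_inf Astar).
exists (reduction m sigma e U F); first exact: continuous_reduction.
apply/seteqP; split=> [_ [[x y] Pxy <-]|x].
  apply: (reduction_positive A1 clT A2 A3 A4 m_homo ellbar_inf remove_one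
    Astar_max ellbar_homo sigma_inj sigma_surj e_inj U_base clF (y := y)) => z Fz.
  suff : (~` P) (x, y) by [].
  by rewrite PF; exists ((x, y), z).
move=> /(positive_reduction A1 clT A2 A3 A4 m_homo ellbar_inf remove_one
  Astar_max sigma_inj e_inj)[y nF].
exists (x, y) => //; apply: contrapT => nP.
have : (~` P) (x, y) by [].
by rewrite PF => -[[p z] Fp pE]; apply: (nF z); rewrite -pE.
Qed.
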